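(* Assume the bipartite graph $\mathcal{T}$ is a tree of diameter $3$. Consider the system, for measurable locally bounded functions $w_i,y_i$ ($i\in\mathcal{I}$), $z_j$ ($j\in\mathcal{J}$), $\psi_{ij}$ (with $\psi_{ij}=0$ for $i\not\sim j$) on an interval: $$\text{(S1)}\ \sum_{j\in\mathcal{J}}(\psi_{ij}+\mu_{ij}\mathfrak{J}\psi_{ij})=w_i-y_i-\theta_i\mathfrak{J}y_i,\ i\in\mathcal{I};\quad \text{(S2)}\ \sum_{i\in\mathcal{I}}\psi_{ij}=-z_j,\ j\in\mathcal{J};$$ $$\text{(S3)}\ y_i\ge0,\ z_j\ge0;\quad \text{(S4)}\ \min(e\cdot y,e\cdot z)=0.$$ Suppose this system has the nonidling property: for every $T>0$, whenever (S1)–(S4) hold on $[0,T)$, $w_i(0)>0$ and each $w_i$ is strictly increasing and right-continuous on $[0,T)$, then $z_j(t)=0$ for all $t\in[0,T)$, $j\in\mathcal{J}$. Then there is a constant $m_4$ such that for every $(\psi,y,z,w)$ satisfying (S1)–(S4) on $[0,\infty)$, with $x_i:=w_i-\sum_{j}\mu_{ij}\mathfrak{J}\psi_{ij}-\theta_i\mathfrak{J}y_i$, $$\|x(t)\|\le m_4(1+t)^{m_4}(1+\|w\|_t^* ),\qquad t\ge0;$$ $m_4$ does not depend on $t,w,y,z,\psi$.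
   Context: $\mathcal{I}=\{1,\dots,I\}$, $\mathcal{J}=\{I+1,\dots,I+J\}$, $\mathcal{E}\subset\mathcal{I}\times\mathcal{J}$, $i\sim j$ iff $(i,j)\in\mathcal{E}$; $\mathcal{T}$ is the bipartite graph with vertices $\mathcal{I}\cup\mathcal{J}$ and edges $\mathcal{E}$. Constants $\mu_{ij}>0$ for $(i,j)\in\mathcal{E}$, $\mu_{ij}=0$ otherwise, $\theta_i\ge0$. $\mathfrak{J}f(t)=\int_0^tf(s)ds$. $\|x\|=\sum|x_i|$, $\|w\|_t^*=\sup_{0\le s\le t}\|w(s)\|$, $e=(1,\dots,1)'$. *)

(* Defs.v *)
From HB Require Import structures.
From mathcomp Require Import all_boot all_order all_algebra.
From mathcomp Require Import all_classical all_reals all_analysis.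
Set Implicit Arguments. Unset Strict Implicit. Unset Printing Implicit Defensive.
Import Order.TTheory GRing.Theory Num.Theory.
Import numFieldNormedType.Exports.
Local Open Scope classical_set_scope.
Local Open Scope ring_scope.

Definition bip_adj (nI nJ : nat) (E : 'I_nI -> 'I_nJ -> bool) :
    rel ('I_nI + 'I_nJ)%type :=
  fun u v => match u, v with
             | inl i, inr j => E i j
             | inr j, inl i => E i j
             | _, _ => false
             end.

Definition g_connected (V : finType) (adj : rel V) : Prop :=
  forall u v : V, exists p : seq V, path adj u p /\ last u p = v.

Definition g_acyclic (V : finType) (adj : rel V) : Prop :=
  forall c : seq V, uniq c -> cycle adj c -> (size c <= 2)%N.

Definition is_tree (V : finType) (adj : rel V) : Prop :=
  g_connected adj /\ g_acyclic adj.

Definition dist_le (V : finType) (adj : rel V) (u v : V) (k : nat) : Prop :=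
  exists p : seq V, [/\ path adj u p, last u p = v & (size p <= k)%N].

Definition diameter_eq (V : finType) (adj : rel V) (d : nat) : Prop :=
  (forall u v : V, dist_le adj u v d) /\
  (exists u v : V, ~ dist_le adj u v d.-1).

Definition Iv (R : realType) (T : \bar R) : set R :=
  [set t | 0 <= t /\ (t%:E < T)%E].

Definition Jint (R : realType) (f : R -> R) (t : R) : R :=
  Rintegral (@lebesgue_measure R) `[0, t] f.

Definition mlb_on (R : realType) (T : \bar R) (f : R -> R) : Prop :=
  measurable_fun (Iv T) f /\
  forall s, Iv T s -> exists M : R, forall u, 0 <= u <= s -> `|f u| <= M.

Definition sol_on (R : realType) (nI nJ : nat) (E : 'I_nI -> 'I_nJ -> bool)
    (mu : 'I_nI -> 'I_nJ -> R) (theta : 'I_nI -> R) (T : \bar R)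
    (psi : 'I_nI -> 'I_nJ -> R -> R) (y : 'I_nI -> R -> R)
    (z : 'I_nJ -> R -> R) (w : 'I_nI -> R -> R) : Prop :=
  (forall i j, mlb_on T (psi i j)) /\
  (forall i, mlb_on T (y i)) /\ (forall j, mlb_on T (z j)) /\
  (forall i, mlb_on T (w i)) /\
  (forall i j t, ~~ E i j -> Iv T t -> psi i j t = 0) /\
      (forall i t, Iv T t ->
        \sum_(j < nJ) (psi i j t + mu i j * Jint (psi i j) t)
          = w i t - y i t - theta i * Jint (y i) t) /\
      (forall j t, Iv T t -> \sum_(i < nI) psi i j t = - z j t) /\
      (forall t, Iv T t -> (forall i, 0 <= y i t) /\ (forall j, 0 <= z j t)) /\
      (forall t, Iv T t ->
        Num.min (\sum_(i < nI) y i t) (\sum_(j < nJ) z j t) = 0).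

Definition nonidling (R : realType) (nI nJ : nat) (E : 'I_nI -> 'I_nJ -> bool)
    (mu : 'I_nI -> 'I_nJ -> R) (theta : 'I_nI -> R) : Prop :=
  forall (T : R), 0 < T ->
  forall psi y z w, sol_on E mu theta T%:E psi y z w ->
    (forall i, 0 < w i 0) ->
    (forall i s t, Iv T%:E s -> Iv T%:E t -> s < t -> w i s < w i t) ->
    (forall i t, Iv T%:E t -> w i x @[x --> t^'+] --> w i t) ->
    forall j t, Iv T%:E t -> z j t = 0.

Definition xproc (R : realType) (nI nJ : nat)
    (mu : 'I_nI -> 'I_nJ -> R) (theta : 'I_nI -> R)
    (psi : 'I_nI -> 'I_nJ -> R -> R) (y : 'I_nI -> R -> R)
    (w : 'I_nI -> R -> R) (i : 'I_nI) (t : R) : R :=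
  w i t - \sum_(j < nJ) mu i j * Jint (psi i j) t - theta i * Jint (y i) t.

Definition norm1 (R : realType) (n : nat) (v : 'I_n -> R) : R :=
  \sum_(i < n) `|v i|.

Definition supnorm (R : realType) (n : nat) (w : 'I_n -> R -> R) (t : R) : R :=
  sup [set norm1 (fun i => w i s) | s in `[0, t]].

(* Main.v *)
Require Import Defs.
From HB Require Import structures.
From mathcomp Require Import all_boot all_order all_algebra.
From mathcomp Require Import all_classical all_reals all_analysis.
From mathcomp Require Import measurable_realfun ring lra.
Import Order.TTheory GRing.Theory Num.Theory.
Import numFieldNormedType.Exports.
Set Implicit Arguments. Unset Strict Implicit. Unset Printing Implicit Defensive.
Local Open Scope classical_set_scope.
Local Open Scope ring_scope.

(** A bipartite tree of diameter 3 is a double star: the edges are exactly the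
    [(i0, j)] and the [(i, j0)].  Put [lam i := mu i j0].  Since [psi i0 j = - z j]
    for [j != j0], the system reads
      [x i' = w i' - lam i * x i + (lam i - theta i) * y i
              + [i = i0] * \sum_j (mu i0 j - lam i0) * z j],
    where [\sum_i x i = Y - Z], with [Y], [Z] the totals of [y], [z].

    Nonidling forces [theta b <= lam b] for every class [b] whose [lam b] is not
    maximal: otherwise, while the whole queue is kept in class [b], [x b] is driven
    below zero and then decays more slowly than the positive [x a] of a class with
    [lam a > lam b], so that the total becomes negative.

    Conversely, let [Lam] be the maximum of [lam].  The conditions above keep
    [x i - w i] bounded below when [i != i0] and [lam i < Lam].  Two coupled
    barriers, for [x i0 - w i0] and for the total, form a contraction because
    [lam i0 - mu i0 j < lam i0]; they bound [Z] by a multiple of [1 + ||w||].  Then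
    [\sum_i (x i - w i) / lam i] has drift at most a multiple of [Z], hence grows at
    most linearly, and with it the total, [Y], and finally each [x i]. *)

(** * The integral operator on locally bounded functions *)

Lemma Iv_pinfty (R : realType) : Iv (+oo%E : \bar R) = `[0, +oo[%classic.
Proof.
apply/seteqP; split => t /=; rewrite in_itv /= andbT; first by case.
by move=> t0; split => //; exact: ltry.
Qed.

Section Jint_theory.
Context {R : realType}.
Implicit Types (f g : R -> R) (s t k : R).

Notation mlb := (@mlb_on R +oo%E).

Lemma mlb_measurable_itv f s t : 0 <= s -> mlb f ->
  measurable_fun `[s, t] f.
Proof.
move=> s0 [mf _]; apply: measurable_funS mf; rewrite Iv_pinfty //.
by apply: subset_itv => //; rewrite bnd_simp.
Qed.

Lemma mlb_integrable f t : mlb f ->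
  (@lebesgue_measure R).-integrable `[0, t] (EFin \o f).
Proof.
move=> mf; apply: measurable_bounded_integrable => //=.
- by rewrite lebesgue_measure_itv/=; case: ifP => // _; rewrite -EFinB ltry.
- exact: mlb_measurable_itv.
- case: (leP 0 t) => t0; last first.
    by exists 0; split => // ? _ x /=; rewrite in_itv /= => /andP[? ?]; lra.
  case: mf => _ /(_ t); case; first by rewrite Iv_pinfty /= in_itv /= t0.
  move=> M HM; exists M; split => [|M' MM' x /=]; first exact: num_real.
  by rewrite in_itv /= => xt; rewrite (le_trans (HM _ xt))// ltW.
Qed.

Lemma mlb_continuous f : continuous f -> mlb f.
Proof.
move=> cf; split.
  apply: measurable_funS (continuous_measurable_fun cf) => //.
move=> s [s0 _].
have [x _ Hx] := EVT_max s0 (continuous_subspaceT (fun x => cvg_norm (cf x))).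
by exists `|f x| => u us; apply: Hx; rewrite in_itv.
Qed.

Lemma mlbD f g : mlb f -> mlb g -> mlb (f \+ g).
Proof.
move=> [mf bf] [mg bg]; split; first exact: measurable_funD.
move=> s Is; have [M HM] := bf _ Is; have [N HN] := bg _ Is.
exists (M + N) => u us /=; rewrite (le_trans (ler_normD _ _))// lerD//.
  exact: HM.
exact: HN.
Qed.

Lemma mlbZ k f : mlb f -> mlb (fun t => k * f t).
Proof.
move=> [mf bf]; split; first exact: measurable_funM.
move=> s Is; have [M HM] := bf _ Is.
exists (`|k| * M) => u us /=; rewrite normrM ler_wpM2l //; exact: HM.
Qed.

Lemma mlb0 : mlb (fun=> 0).
Proof. by apply: mlb_continuous => x; exact: cvg_cst. Qed.

Lemma mlb_sum (I : Type) (r : seq I) (P : pred I) (F : I -> R -> R) :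
  (forall i, mlb (F i)) -> mlb (fun t => \sum_(i <- r | P i) F i t).
Proof.
move=> mF; elim: r => [|i r IH].
  by under eq_fun do rewrite big_nil; exact: mlb0.
under eq_fun do rewrite big_cons.
by case: (P i) => //; exact: mlbD.
Qed.

Lemma JintD f g t : mlb f -> mlb g -> Jint (f \+ g) t = Jint f t + Jint g t.
Proof. by move=> mf mg; rewrite /Jint RintegralD//; exact: mlb_integrable. Qed.

Lemma JintZ k f t : mlb f -> Jint (fun t => k * f t) t = k * Jint f t.
Proof. by move=> mf; rewrite /Jint RintegralZl//; exact: mlb_integrable. Qed.

Lemma Jint_le0 f t : t <= 0 -> Jint f t = 0.
Proof.
rewrite le_eqVlt => /predU1P[->|t0]; first by rewrite /Jint set_itv1 Rintegral_set1.
by rewrite /Jint set_itv_ge ?Rintegral_set0// bnd_simp -ltNge.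
Qed.

Lemma Jint_sum (I : Type) (r : seq I) (P : pred I) (F : I -> R -> R) t :
  (forall i, mlb (F i)) ->
  Jint (fun t => \sum_(i <- r | P i) F i t) t = \sum_(i <- r | P i) Jint (F i) t.
Proof.
move=> mF; elim: r => [|i r IH].
  rewrite big_nil; under eq_fun do rewrite big_nil.
  by rewrite /Jint Rintegral_cst// mul0r.
rewrite big_cons; under eq_fun do rewrite big_cons.
case: (P i) => //; rewrite -IH -JintD//; exact: mlb_sum.
Qed.

Lemma Jint_incr f s t : mlb f -> 0 <= s <= t ->
  Jint f t - Jint f s = \int[lebesgue_measure]_(x in `]s, t]) f x.
Proof.
move=> mf /andP[s0 st]; rewrite /Jint Rintegral_itvB//.
exact: mlb_integrable.
Qed.

Lemma Jint_cst k t : 0 <= t -> Jint (fun=> k) t = k * t.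
Proof.
move=> t0; rewrite /Jint Rintegral_cst//= lebesgue_measure_itv/= lte_fin.
case: ltP => t0' /=; first by rewrite oppr0 addr0.
by rewrite (le_anti (introT andP (conj t0' t0))).
Qed.

Lemma Jint_nondecreasing f s t : mlb f -> 0 <= s <= t ->
  (forall u, s < u <= t -> 0 <= f u) -> Jint f s <= Jint f t.
Proof.
move=> mf st f0; rewrite -subr_ge0 Jint_incr//; apply: Rintegral_ge0 => x /=.
by rewrite in_itv; exact: f0.
Qed.

Lemma Jint_incr_ge k f s t : mlb f -> 0 <= s <= t ->
  (forall u, s < u <= t -> k <= f u) -> k * (t - s) <= Jint f t - Jint f s.
Proof.
move=> mf st kf.
have mk : mlb (fun=> - k) by apply: mlb_continuous => x; exact: cvg_cst.
have := @Jint_nondecreasing (f \+ (fun=> - k)) s t (mlbD mf mk) st.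
rewrite !JintD// !Jint_cst; try lra.
have H : forall u, s < u <= t -> 0 <= (f \+ (fun=> - k)) u.
  by move=> u ut /=; rewrite subr_ge0 kf.
move=> /(_ H); lra.
Qed.

Lemma Jint_incr_le k f s t : mlb f -> 0 <= s <= t ->
  (forall u, s < u <= t -> f u <= k) -> Jint f t - Jint f s <= k * (t - s).
Proof.
move=> mf st kf; have := @Jint_incr_ge (- k) _ s t (mlbZ (-1) mf) st.
rewrite !JintZ//.
have H : forall u, s < u <= t -> - k <= -1 * f u.
  by move=> u ut /=; rewrite mulN1r lerN2 kf.
move=> /(_ H); lra.
Qed.

Lemma mlb_bounded f T : mlb f -> exists2 M, 0 <= M & forall u, 0 <= u <= T -> `|f u| <= M.
Proof.
move=> [_ bf]; case: (leP 0 T) => T0; last by exists 0 => // u; lra.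
have /bf[M HM] : Iv +oo%E T by rewrite Iv_pinfty /= in_itv /= T0.
exists M => //; apply: le_trans (HM 0 _) => //; lra.
Qed.

Lemma continuous_Jint f : mlb f -> continuous (Jint f).
Proof.
move=> mf t.
have [M M0 HM] := mlb_bounded (`|t| + 1) mf.
have ltx (x : R) : x <= `|x| by exact: ler_norm.
have lip s u : 0 <= s <= u -> u <= `|t| + 1 -> `|Jint f u - Jint f s| <= M * (u - s).
  move=> su ut; rewrite ler_norml; apply/andP; split.
    rewrite -mulNr; apply: Jint_incr_ge => // v vs.
    have /HM : 0 <= v <= `|t| + 1 by lra.
    by rewrite ler_norml => /andP[].
  apply: Jint_incr_le => // v vs.
  have /HM : 0 <= v <= `|t| + 1 by lra.
    by rewrite ler_norml => /andP[].
(* At negative times the integral runs over an empty interval and vanishes, so clamping the times at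
   0 extends the Lipschitz estimate to the whole line. *)
have pos s : Jint f s = Jint f (Num.max 0 s).
  by case: (leP 0 s) => // s0; rewrite !Jint_le0// ltW.
have lip2 s u : s <= u -> u <= `|t| + 1 -> `|Jint f u - Jint f s| <= M * (u - s).
  move=> su ut; rewrite pos (pos s).
  have t0 : 0 <= `|t| by [].
  apply: (@le_trans _ _ (M * (Num.max 0 u - Num.max 0 s))).
    apply: lip; case: (leP 0 u); case: (leP 0 s); lra.
  apply: ler_wpM2l => //; case: (leP 0 u); case: (leP 0 s); lra.
apply/cvgrPdist_le => e e0.
have M1 : 0 < M + 1 by lra.
have d0 : 0 < Num.min 1 (e / (M + 1)) by rewrite lt_min divr_gt0// ltr01.
near=> u.
have : `|t - u| < Num.min 1 (e / (M + 1)) by near: u; exact: cvgr_dist_lt.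
rewrite lt_min => /andP[tu1 tue].
have {}tue : M * `|t - u| <= e.
  apply: (@le_trans _ _ ((M + 1) * `|t - u|)); first by rewrite ler_wpM2r// lerDl.
  by rewrite mulrC -ler_pdivlMr// ltW.
apply: le_trans tue.
case: (leP u t) => ut.
  by rewrite (ger0_norm (x := t - u)) ?subr_ge0//; apply: lip2 => //; have := ltx t; lra.
rewrite distrC (distrC t) (ger0_norm (x := u - t)); last lra.
apply: lip2; first lra.
by move: tu1; rewrite ltr_norml; have := ltx t; lra.
Unshelve. all: by end_near.
Qed.

Lemma Jint_FTC2 f F : continuous f -> (forall x : R, is_derive x 1 F (f x)) ->
  forall t, 0 <= t -> Jint f t = F t - F 0.
Proof.
move=> cf dF t; rewrite le_eqVlt => /predU1P[<-|t0]; first by rewrite Jint_le0// subrr.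
have cF : continuous F.
  by move=> x; apply/differentiable_continuous/derivable1_diffP; case: (dF x).
rewrite /Jint /Rintegral (@continuous_FTC2 _ f F)//.
- exact: continuous_subspaceT.
- split; first by move=> x _; case: (dF x).
  + exact: (cvg_at_right_filter (cF 0)).
  + exact: (cvg_at_left_filter (cF t)).
- by move=> x _; rewrite derive1E derive_val.
Qed.

(* After its last visit to [[- B, oo)], [c + Jint f] would be nondecreasing. *)
Lemma Jint_barrier f c B T : mlb f -> 0 <= T -> - B <= c ->
  (forall s, 0 <= s <= T -> c + Jint f s < - B -> 0 <= f s) ->
  forall s, 0 <= s <= T -> - B <= c + Jint f s.
Proof.
move=> mf T0 Bc H t1 t1T; rewrite leNgt; apply/negP => lt1.
pose A := [set s | 0 <= s <= t1 /\ - B <= c + Jint f s].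
have A0 : A 0 by split; [lra|rewrite Jint_le0 ?addr0].
have ubA : ubound A t1 by move=> s [/andP[]].
have supA : has_sup A by split; [exists 0|exists t1].
have s00 : 0 <= sup A by exact: ub_le_sup (ex_intro _ _ ubA) _ A0.
have s0t : sup A <= t1 by exact: ge_sup (ex_intro _ _ A0) ubA.
have [M M0 HM] := mlb_bounded T mf.
pose d := - B - (c + Jint f t1).
have d0 : 0 < d by rewrite /d; lra.
(* The supremum need not be known to lie in [A]. A point [s] of [A] this close to it suffices: since
   [f >= - M], the integral falls by less than the deficit [d] between [s] and [sup A], and it does
   not fall afterwards. *)
have e0 : 0 < d / (M + 1) by rewrite divr_gt0//; lra.
have [s As ls] := sup_adherent e0 supA.
have ss0 : s <= sup A by exact: ub_le_sup (ex_intro _ _ ubA) _ As.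
case: As => st1 Bs.
have h1 : Jint f (sup A) <= Jint f t1.
  apply: Jint_nondecreasing => // [|u /andP[lu ut]]; first lra.
  apply: H; first lra.
  rewrite ltNge; apply/negP => Bu.
  suff : u <= sup A by lra.
  by apply: ub_le_sup (ex_intro _ _ ubA) _ _; split => //; lra.
have h2 : - M * (sup A - s) <= Jint f (sup A) - Jint f s.
  apply: Jint_incr_ge => // [|u us]; first lra.
  have /HM : 0 <= u <= T by lra.
  by rewrite ler_norml => /andP[].
have h3 : M * (sup A - s) < d.
  apply: (@le_lt_trans _ _ ((M + 1) * (sup A - s))); first by rewrite ler_wpM2r//; lra.
  by rewrite mulrC -ltr_pdivlMr; lra.
move: h2 h3; rewrite /d mulNr; lra.
Qed.

End Jint_theory.

(** * Trees of diameter 3 *)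

Section double_star.
Let sum_eqE (A B : eqType) : ((forall a b : A, (inl a == inl b :> A + B) = (a == b)) *
  (forall a b : B, (inr a == inr b :> A + B) = (a == b)))%type.
Proof. by []. Qed.

Variables (nI nJ : nat) (E : 'I_nI -> 'I_nJ -> bool).
Hypothesis acyclicE : g_acyclic (bip_adj E).

Lemma acyclic_no_4cycle i i' j j' : E i j -> E i' j -> E i' j' -> E i j' ->
  i != i' -> j = j'.
Proof.
move=> e1 e2 e3 e4 ii'; apply/eqP; apply: contraT => jj'.
have := acyclicE (c := [:: inl i; inr j; inl i'; inr j']).
by rewrite /= e1 e2 e3 e4 !inE /= !sum_eqE (negbTE ii') jj' => /(_ isT isT).
Qed.

Lemma acyclic_no_6cycle i1 i2 i3 j1 j2 j3 :
  E i1 j1 -> E i2 j1 -> E i2 j2 -> E i3 j2 -> E i3 j3 -> E i1 j3 ->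
  uniq [:: i1; i2; i3] -> uniq [:: j1; j2; j3] -> False.
Proof.
move=> e1 e2 e3 e4 e5 e6 /= /and3P[+ + _] /= /and3P[+ + _].
rewrite !inE !negb_or => /andP[h1 h2] h3 /andP[h4 h5] h6.
have := acyclicE (c := [:: inl i1; inr j1; inl i2; inr j2; inl i3; inr j3]).
rewrite /= e1 e2 e3 e4 e5 e6 !inE /= !negb_or.
by rewrite !sum_eqE h1 h2 h3 h4 h5 h6 => /(_ isT isT).
Qed.

Hypothesis diamE : diameter_eq (bip_adj E) 3.

(** Walks between vertices of the same side have even length, so a length of at most 3 means 0 or
    2. *)
Lemma dist_le3_inl i i' : dist_le (bip_adj E) (inl i) (inl i') 3 ->
  i = i' \/ exists2 j, E i j & E i' j.
Proof.
case=> [[|[a|j] [|[i2|b] [|[i3|c] [|d p]]]]] [] //=; rewrite ?andbF //.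
- by move=> _ [->]; left.
- by rewrite andbT => /andP[h1 h2] [<-] _; right; exists j.
Qed.

Lemma dist_le3_inr j j' : dist_le (bip_adj E) (inr j) (inr j') 3 ->
  j = j' \/ exists2 i, E i j & E i j'.
Proof.
case=> [[|[i|a] [|[b|j2] [|[c|j3] [|d p]]]]] [] //=; rewrite ?andbF //.
- by move=> _ [->]; left.
- by rewrite andbT => /andP[h1 h2] [<-] _; right; exists i.
Qed.

Lemma common_nbr_inl i i' : i = i' \/ exists2 j, E i j & E i' j.
Proof. exact/dist_le3_inl/diamE.1. Qed.

Lemma common_nbr_inr j j' : j = j' \/ exists2 i, E i j & E i j'.
Proof. exact/dist_le3_inr/diamE.1. Qed.

(** Two vertices not within distance 2 are joined by a walk of exactly three edges. By parity they
    lie on opposite sides, and they cannot be adjacent. *)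
Lemma diameter3_path : exists i1 j0 i0 j1,
  [/\ E i1 j0, E i0 j0, E i0 j1 & ~~ E i1 j1].
Proof.
have [u [v nuv]] := diamE.2.
case: (diamE.1 u v) => p [pp lp sp].
have {sp} : size p = 3.
  apply/eqP; rewrite eqn_leq sp ltnNge; apply/negP => sp2.
  by apply: nuv; exists p.
move: pp lp nuv; case: p => [|a [|b [|c [|? ?]]]] //= + + + _.
case: u => [i1|j1]; case: a => [a|a] //; case: b => [b|b]; rewrite ?andbF //;
  case: c => [c|c]; rewrite ?andbF //.
- move=> /and4P[e1 e2 e3 _] <- nd; exists i1, a, b, c; split => //.
  apply/negP => e; apply: nd; exists [:: inr c]; split => //=.
  by rewrite e.
- move=> /and4P[e1 e2 e3 _] <- nd; exists c, b, a, j1; split => //.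
  apply/negP => e; apply: nd; exists [:: inl c]; split => //=.
  by rewrite e.
Qed.

(** The inner vertices [j0] and [i0] of a path of length 3 are the two centres. Its ends are leaves,
    so any vertex sharing a neighbour with an end is attached to the centre next to that end. *)
Lemma diameter3_tree_double_star : exists i0 j0, forall i j,
  E i j = (i == i0) || (j == j0).
Proof.
have [i1 [j0 [i0 [j1 [e10 e00 e01 n11]]]]] := diameter3_path.
have i10 : i1 != i0 by apply: contraNneq n11 => ->.
have j10 : j0 != j1 by apply: contraNneq n11 => <-.
(* A second neighbour [j] of [i1] would share a neighbour [i] with [j1]. This closes a 4-cycle if
   [i = i0], and otherwise a 6-cycle. *)
have leaf_i1 j : E i1 j -> j = j0.
  move=> e1j; have [jj1|[i eij eij1]] := common_nbr_inr j j1.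
    by rewrite -jj1 e1j in n11.
  have [ii0|ni0] := eqVneq i i0.
    by apply: (acyclic_no_4cycle (i := i1) (i' := i0)); rewrite // -ii0.
  have ii1 : i != i1 by apply: contraNneq n11 => <-.
  have [//|njj0] := eqVneq j j0; have njj1 : j != j1.
    by apply: contraNneq n11 => <-.
  exfalso; apply: (@acyclic_no_6cycle i1 i0 i j0 j1 j) => //=.
    by rewrite !inE !negb_or i10 (eq_sym i1) ii1 (eq_sym i0) ni0.
  by rewrite !inE !negb_or j10 eq_sym njj0 eq_sym njj1.
have leaf_j1 i : E i j1 -> i = i0.
  move=> ei1; have [ii1|[j eij e1j]] := common_nbr_inl i i1.
    by rewrite -ii1 ei1 in n11.
  apply/eqP; apply: contraT => ni0; case/eqP: j10.
  rewrite (leaf_i1 _ e1j) in eij.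
  exact: (acyclic_no_4cycle (i := i) (i' := i0)).
have Ei i : E i j0.
  have [->//|[j eij e1j]] := common_nbr_inl i i1.
  by rewrite -(leaf_i1 _ e1j).
have Ej j : E i0 j.
  have [->//|[i eij e1i]] := common_nbr_inr j j1.
  by rewrite -(leaf_j1 _ e1i).
exists i0, j0 => i j; have [->|ni] := eqVneq i i0; first exact: Ej.
have [->|nj] := eqVneq j j0; first exact: Ei.
(* An edge avoiding both centres would close a 4-cycle with the edge [i0], [j0]. *)
apply/negP => eij; case/eqP: nj.
exact: (acyclic_no_4cycle eij (Ej j) e00 (Ei i) ni).
Qed.

End double_star.

(** * Consequences of nonidling *)

Lemma mlb_on_fin (R : realType) (T : R) (f : R -> R) :
  mlb_on +oo%E f -> mlb_on T%:E f.
Proof.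
have sub : Iv T%:E `<=` Iv +oo%E by move=> t [t0 _]; split => //; exact: ltry.
move=> [mf bf]; split=> [|s /sub]; last exact: bf.
by apply: measurable_funS mf => //; rewrite Iv_pinfty.
Qed.

Section nonidling_rates.
Context {R : realType} (nI nJ : nat) (E : 'I_nI -> 'I_nJ -> bool).
Variables (mu : 'I_nI -> 'I_nJ -> R) (theta : 'I_nI -> R) (j0 : 'I_nJ).
Hypothesis Ej0 : forall i, E i j0.
Hypothesis nidl : nonidling E mu theta.

(* Here all the idleness is put at [j0] and [w] is recovered from [x] and [y];
   the lower bound [a i] makes [w i] strictly increasing. *)
Lemma nonidling_total_ge0 (x dx y : 'I_nI -> R -> R) (a : 'I_nI -> R) (T : R) :
  (forall i (t : R), is_derive t 1 (x i) (dx i t)) ->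
  (forall i, continuous (dx i)) -> (forall i, continuous (y i)) ->
  (forall i t, 0 <= y i t) ->
  (forall t, \sum_i y i t = Num.max 0 (\sum_i x i t)) ->
  (forall i, 0 < x i 0) -> (forall i, 0 < a i) -> 0 < T ->
  (forall i t, 0 <= t <= T ->
     a i <= dx i t + mu i j0 * (x i t - y i t) + theta i * y i t) ->
  forall t, 0 <= t < T -> 0 <= \sum_i x i t.
Proof.
move=> xdx cdx cy y0 sumy x0 a0 T0 adx t /andP[t0 tT].
have cx i : continuous (x i).
  by move=> u; apply/differentiable_continuous/derivable1_diffP; case: (xdx i u).
have mdx i : mlb_on +oo%E (dx i) by exact: mlb_continuous.
have my i : mlb_on +oo%E (y i) by exact: mlb_continuous.
have mx i : mlb_on +oo%E (x i) by exact: mlb_continuous.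
pose q i := x i \+ (fun t => -1 * y i t).
have mq i : mlb_on +oo%E (q i) by apply: mlbD => //; exact: mlbZ.
pose h i := dx i \+ ((fun t => mu i j0 * q i t) \+ (fun t => theta i * y i t)).
have mh i : mlb_on +oo%E (h i).
  by apply: mlbD => //; apply: mlbD; apply: mlbZ.
(* This is (S1) solved for [w], with [psi i j0 = q i = x i - y i] and every other [psi] zero. Its
   derivative is [h i], which the assumed lower bound keeps above [a i]. *)
pose w i t := x i t + (mu i j0 * Jint (q i) t + theta i * Jint (y i) t).
have wE i u : 0 <= u -> w i u = x i 0 + Jint (h i) u.
  move=> u0; rewrite /h !JintD ?JintZ//; last 3 first.
  - exact: mlbZ.
  - exact: mlbZ.
  - by apply: mlbD; apply: mlbZ.
  by rewrite (Jint_FTC2 (cdx i) (xdx i) u0) /w; ring.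
have cw i : continuous (w i).
  move=> u; apply: cvgD; first exact: cx.
  by apply: cvgD; (apply: cvgM; [exact: cvg_cst | exact: continuous_Jint]).
pose psi i j : R -> R := if j == j0 then q i else fun=> 0.
(* The negative part of the total; nonidling will make it vanish. *)
pose z j : R -> R := if j == j0 then
  (fun t => Num.max 0 (\sum_i x i t)  + (-1 * \sum_i x i t)) else fun=> 0.
have mX : mlb_on +oo%E (fun t => \sum_i x i t) by exact: mlb_sum.
have mz j : mlb_on +oo%E (z j).
  rewrite /z; case: ifP => _; last exact: mlb0.
  apply: mlbD; last exact: mlbZ.
  by under eq_fun do rewrite -sumy; exact: mlb_sum.
have z0 u : Num.max 0 (\sum_i x i u) + (-1 * \sum_i x i u) = 0 -> 0 <= \sum_i x i u.
  by case: (leP 0 (\sum_i x i u)); lra.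
apply: z0.
have -> : Num.max 0 (\sum_i x i t) + (-1 * \sum_i x i t) = z j0 t.
  by rewrite /z eqxx.
apply: (nidl T0 (psi := psi) (y := y) (z := z) (w := w)); last by split.
- split; [|split; [|split; [|split; [|split; [|split; [|split; [|split]]]]]]].
  + move=> i j; apply: mlb_on_fin; rewrite /psi; case: ifP => // _; exact: mlb0.
  + by move=> i; apply: mlb_on_fin.
  + by move=> j; apply: mlb_on_fin.
  + by move=> i; apply: mlb_on_fin; apply: mlb_continuous.
  + move=> i j u nE _; rewrite /psi ifN//; apply: contraNneq nE => ->; exact: Ej0.
  + move=> i u _; rewrite (bigD1 j0)//= big1 => [|j nj]; last first.
      by rewrite /psi (negbTE nj) /Jint Rintegral_cst// mul0r mulr0 addr0.
    rewrite /psi eqxx /w /q /=; lra.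
  + move=> j u _; rewrite /psi /z; case: ifP => _; last by rewrite oppr0 big1.
    rewrite /q /= big_split/= -mulr_sumr sumy; lra.
  + move=> u _; split => [i|j]; first exact: y0.
    rewrite /z; case: ifP => // _; case: (leP 0 (\sum_i x i u)); lra.
  + move=> u _.
    have -> : \sum_j z j u = z j0 u.
      by rewrite (bigD1 j0)//= big1 ?addr0// => j nj; rewrite /z (negbTE nj).
    rewrite sumy /z eqxx.
    case: (leP 0 (\sum_i x i u)) => h0.
      by rewrite mulN1r subrr; apply/min_idPr.
    by rewrite add0r mulN1r; apply/min_idPl; lra.
- by move=> i; rewrite wE// Jint_le0// addr0.
- move=> i s u [s0 sT] [u0 uT] su; rewrite !wE// ltrD2l -subr_gt0.
  rewrite lte_fin in uT.
  apply: (@lt_le_trans _ _ (a i * (u - s))); first by rewrite mulr_gt0// subr_gt0.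
  apply: Jint_incr_ge => //; first lra.
  move=> v vsu; apply: le_trans (adx i v _) _; first lra.
  rewrite /h /q /=; lra.
- by move=> i u _; exact: cvg_at_right_filter (cw i u).
Qed.

Lemma nonidling_abandonment_le (a b : 'I_nI) :
  (forall i, 0 < mu i j0) -> mu b j0 < mu a j0 -> theta b <= mu b j0.
Proof.
move=> mu0 mba; rewrite leNgt; apply/negP => mth.
have nab : a != b by apply: contraTneq mba => ->; rewrite ltxx.
pose lam := mu b j0.
(* The queue is kept in [b]; [x a] decays at a rate [kap] strictly between [lam] and
   both [mu a j0] and [theta b], and the total [X] changes sign at [1 / del]. *)
pose kap := (lam + Num.min (mu a j0) (theta b)) / 2.
have [lamkap kapa kapth] : [/\ lam < kap, kap < mu a j0 & kap < theta b].
  rewrite /kap /lam; case: (leP (mu a j0) (theta b)) => ?; split; lra.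
have lam0 : 0 < lam by exact: mu0.
(* With this choice [3 * del] is half of [kap - lam], so the decline of the total consumes only half
   of the margin available in the drift of [w b]. *)
pose del := (kap - lam) / 6.
have del0 : 0 < del by rewrite /del; lra.
pose T := 2 / del.
have T0 : 0 < T by rewrite /T divr_gt0.
pose em := expR (- kap * T).
have em0 : 0 < em by exact: expR_gt0.
(* The [N] remaining classes are held at a constant level [c], with sum at most [r]. The bound
   [r <= 1] keeps [x b] positive at time 0, and the other bound on [r] limits the cost in the drift
   of [w b] to a quarter of [(kap - lam) * em]. *)
pose N : R := \sum_(l < nI | (l != b) && (l != a)) 1.
have N0 : 0 <= N by exact: sumr_ge0.
pose r := Num.min 1 ((kap - lam) * em / (4 * lam)).
have r0 : 0 < r.
  rewrite /r lt_min ltr01/= divr_gt0// ?mulr_gt0//; lra.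
have r1 : r <= 1 by rewrite /r ge_min lexx.
have rl : lam * r <= (kap - lam) * em / 4.
  apply: (@le_trans _ _ (lam * ((kap - lam) * em / (4 * lam)))).
    by apply: ler_wpM2l; [exact: ltW|rewrite /r ge_min lexx orbT].
  by rewrite le_eqVlt; apply/orP; left; apply/eqP; field; lra.
pose c := r / (N + 1).
have c0 : 0 < c by rewrite /c divr_gt0//; lra.
have cN : c * N <= r.
  rewrite /c mulrAC ler_pdivrMr; last lra.
  by rewrite mulrDr mulr1 lerDl ltW.
have cN0 : 0 <= c * N by rewrite mulr_ge0// ltW.
pose ex := fun t : R => expR (- kap * t).
(* The total starts at 3, so that [x b] starts at [2 - c * N > 0]. *)
pose X := fun t : R => 3 * (ex t * (1 - del * t)).
pose dX := fun t : R => 3 * (ex t * (- kap * (1 - del * t) - del)).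
pose xb := fun t : R => X t - ex t - c * N.
pose x i : R -> R := if i == b then xb else if i == a then ex else fun=> c.
pose dx i : R -> R := if i == b then fun t => dX t + kap * ex t
  else if i == a then fun t => - kap * ex t else fun=> 0.
pose y i : R -> R := if i == b then fun t => Num.max 0 (X t) else fun=> 0.
have dex (t : R) : is_derive t 1 ex (- kap * ex t).
  rewrite /ex; apply: is_derive_eq.
  by rewrite /GRing.scale /=; ring.
have dXX (t : R) : is_derive t 1 X (dX t).
  rewrite /X; apply: is_derive_eq.
  by rewrite /dX /GRing.scale /=; ring.
have ex_bound t : 0 <= t <= T -> em <= ex t.
  move=> /andP[t0 tT]; rewrite /em /ex ler_expR !mulNr lerN2 ler_wpM2l//; lra.
have cex : continuous ex.
  by move=> u; apply/differentiable_continuous/derivable1_diffP; case: (dex u).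
have cX : continuous X.
  by move=> u; apply/differentiable_continuous/derivable1_diffP; case: (dXX u).
have cdX : continuous dX.
  move=> u; apply: cvgM; first exact: cvg_cst.
  apply: cvgM; first exact: cex.
  apply: cvgB; last exact: cvg_cst.
  apply: cvgM; first exact: cvg_cst.
  apply: cvgB; first exact: cvg_cst.
  by apply: cvgM; [exact: cvg_cst|exact: cvg_id].
have sumx t : \sum_i x i t = X t.
  rewrite (bigD1 b)//= (bigD1 a)//= /x eqxx (negbTE nab) eqxx.
  rewrite (eq_bigr (fun=> c * 1)) => [|l /andP[lb la]]; last first.
    by rewrite (negbTE lb) (negbTE la) mulr1.
  by rewrite -mulr_sumr -/N /xb; ring.
have [u uT uX] : exists2 u, 0 <= u < T & X u < 0.
  exists (3 / 2 / del).
    by rewrite divr_ge0 ?ltW//= /T ltr_pM2r ?invr_gt0//; lra.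
  rewrite /X mulrA pmulr_rlt0 ?mulr_gt0 ?expR_gt0//.
  have -> : del * (3 / 2 / del) = 3 / 2 by field; lra.
  lra.
suff H : forall t, 0 <= t < T -> 0 <= \sum_i x i t by have := H u uT; rewrite sumx; lra.
(* Lower bounds for the derivatives of the [w i]. For [b] it is the last quarter of the margin; the
   sign of [X] is harmless because [lam < kap < theta b]. *)
pose s i := if i == b then (kap - lam) * em / 4 else
  if i == a then (mu a j0 - kap) * em else mu i j0 * c.
apply: (@nonidling_total_ge0 x dx y s T) => //.
- move=> i t; rewrite /x /dx; case: ifP => _.
    rewrite /xb; apply: is_derive_eq; ring.
  by case: ifP => _; [exact: dex|exact: is_derive_cst].
- move=> i t; rewrite /dx; case: ifP => _.
    apply: cvgD; first exact: cdX.
    by apply: cvgM; [exact: cvg_cst|exact: cex].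
  case: ifP => _; last exact: cvg_cst.
  by apply: cvgM; [exact: cvg_cst|exact: cex].
- move=> i t; rewrite /y; case: ifP => _; last exact: cvg_cst.
  by apply: (@continuous_max _ _ (fun=> 0) X); [exact: cvg_cst|exact: cX].
- by move=> i t; rewrite /y; case: ifP => // _; rewrite le_max lexx.
- move=> t; rewrite sumx (bigD1 b)//= big1 => [|l lb]; last first.
    by rewrite /y (negbTE lb).
  by rewrite /y eqxx addr0.
- move=> i; rewrite /x; case: ifP => _; last first.
    by case: ifP => _ //; exact: expR_gt0.
  rewrite /xb /X /ex !mulr0 expR0; lra.
- move=> i; rewrite /s; case: ifP => _; first by rewrite divr_gt0 ?mulr_gt0//; lra.
  by case: ifP => _; rewrite mulr_gt0//; lra.
- move=> i t tT; have emx := ex_bound _ tT; rewrite /s /x /dx /y.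
  case: ifP => [/eqP ->|_].
    rewrite /xb -/lam.
    have e1 : (kap - lam) * em <= (kap - lam) * ex t by rewrite ler_wpM2l//; lra.
    have e2 : lam * (c * N) <= lam * r by rewrite ler_wpM2l// ltW.
    have e3 : 3 * (del * ex t) = (kap - lam) * ex t / 2 by rewrite /del; field.
    have Xdef : dX t = - kap * X t - 3 * (del * ex t) by rewrite /dX /X; ring.
    rewrite Xdef e3.
    case: (leP 0 (X t)) => X0.
      have e4 : 0 <= (theta b - kap) * X t by rewrite mulr_ge0//; lra.
      lra.
    have e4 : 0 <= (kap - lam) * - X t by rewrite mulr_ge0//; lra.
    lra.
  case: ifP => [/eqP ->|_]; last lra.
  have e1 : (mu a j0 - kap) * em <= (mu a j0 - kap) * ex t by rewrite ler_wpM2l//; lra.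
  lra.
Qed.


End nonidling_rates.

(** * Growth of the reduced system *)

(** The infimum of [A] is at most [q] times itself plus [C], hence at most the fixed point
    [C / (1 - q)]. The slack [e] is there because the infimum need not belong to [A]. *)
Lemma contraction_invariant_small (R : realType) (A : set R) (q C e : R) :
  A !=set0 -> lbound A 0 -> (forall m, A m -> A (q * m + C)) ->
  0 <= q < 1 -> 0 < e -> exists2 m, A m & m <= C / (1 - q) + e.
Proof.
move=> A0 lA Aq /andP[q0 q1] e0.
have infA : has_inf A by split => //; exists 0.
have lbA m : A m -> inf A <= m by move=> Am; exact: ge_inf (ex_intro _ _ lA) _ Am.
have hm : inf A <= C / (1 - q).
  rewrite ler_pdivlMr ?subr_gt0//; rewrite leNgt; apply/negP => g.
  pose d := inf A * (1 - q) - C.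
  have d0 : 0 < d by rewrite /d; lra.
  have [m Am lm] := inf_adherent d0 infA.
  have := lbA _ (Aq _ Am).
  have : q * m <= q * (inf A + d) by rewrite ler_wpM2l// ltW.
  have : q * d < 1 * d by rewrite ltr_pM2r.
  rewrite /d; lra.
have [m Am lm] := inf_adherent e0 infA.
by exists m => //; lra.
Qed.

Section reduced_system.
Context {R : realType} (n : nat) (i0 : 'I_n) (lam theta : 'I_n -> R) (Lam rho c : R).
Hypothesis lam_gt0 : forall i, 0 < lam i.
Hypothesis lam_max : forall i, lam i <= Lam.
Hypothesis theta_ge0 : forall i, 0 <= theta i.
Hypothesis theta_le : forall i, lam i < Lam -> theta i <= lam i.
Hypothesis rho_lt : 0 <= rho < lam i0.
Hypothesis c_ge0 : 0 <= c.

(** The two ratios are the contraction factors of the barriers for class [i0] and for the total.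
    Below, [Cm * M] is the depth of these barriers, [(Cm + 1) * M] bounds [Z], [D * M] bounds the
    drift of the sum weighted by [1 / lam i], and [D2 * (1 + T) * M] bounds [Y]. *)
Let q : R := Num.max (rho / lam i0) ((Lam - lam i0) / (Lam - rho)).
Let K1 : R := \sum_i (Lam - lam i).
Let Cm : R := (2 + 2 * K1 / (Lam - rho)) / (1 - q) + 1.
Let D : R := (1 + c / lam i0) * (Cm + 1).
Let K2 : R := \sum_i (Lam / lam i - 1).
Let D2 : R := Lam * D + K2 * (Cm + 1) + 1.
Definition reduced_system_cst i : R :=
  ((lam i + theta i) * D2 + (rho + c) * (Cm + 1) + lam i) / lam i + 1.

Variables (x y w h : 'I_n -> R -> R) (Y Z d : R -> R) (M T : R).
Hypothesis T_ge0 : 0 <= T.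
Hypothesis M_ge1 : 1 <= M.
Hypothesis mlb_h : forall i, mlb_on +oo%E (h i).
Hypothesis w_le : forall i u, 0 <= u <= T -> `|w i u| <= M.
Hypothesis sumw_le : forall u, 0 <= u <= T -> `|\sum_i w i u| <= M.
Hypothesis xE : forall i u, 0 <= u <= T -> x i u = w i u + Jint (h i) u.
Hypothesis hE : forall i u, 0 <= u <= T ->
  h i u = - lam i * x i u + (lam i - theta i) * y i u + (i == i0)%:R * d u.
Hypothesis d_ge : forall u, 0 <= u <= T -> - rho * Z u <= d u.
Hypothesis d_le : forall u, 0 <= u <= T -> d u <= c * Z u.
Hypothesis sumx : forall u, 0 <= u <= T -> \sum_i x i u = Y u - Z u.
Hypothesis sumy : forall u, 0 <= u <= T -> \sum_i y i u = Y u.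
Hypothesis y_ge0 : forall i u, 0 <= u <= T -> 0 <= y i u.
Hypothesis Z_ge0 : forall u, 0 <= u <= T -> 0 <= Z u.
Hypothesis YZ0 : forall u, 0 <= u <= T -> Num.min (Y u) (Z u) = 0.

Let eta i := Jint (h i).
Let S u := \sum_i eta i u.

Let Lam_gt0 : 0 < Lam. Proof. exact: lt_le_trans (lam_gt0 i0) (lam_max i0). Qed.

Let Lam_rho : 0 < Lam - rho.
Proof. by have := lam_max i0; case/andP: rho_lt => _; lra. Qed.

Let q_ge0 : 0 <= q.
Proof.
rewrite /q le_max; apply/orP; left; case/andP: rho_lt => r0 _.
by rewrite divr_ge0// ltW.
Qed.

Let q_lt1 : q < 1.
Proof.
rewrite /q gt_max; case/andP: rho_lt => r0 r1; apply/andP; split.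
  by rewrite ltr_pdivrMr// mul1r.
by rewrite ltr_pdivrMr// mul1r; lra.
Qed.

Let K1_ge0 : 0 <= K1.
Proof. by apply: sumr_ge0 => i _; rewrite subr_ge0. Qed.

Let K2_ge0 : 0 <= K2.
Proof. by apply: sumr_ge0 => i _; rewrite subr_ge0 ler_pdivlMr// mul1r. Qed.

Let Cm_ge1 : 1 <= Cm.
Proof.
rewrite /Cm lerDr divr_ge0//; last by rewrite subr_ge0 ltW.
by rewrite addr_ge0// divr_ge0 ?mulr_ge0// ltW.
Qed.

Let Y_ge0 u : 0 <= u <= T -> 0 <= Y u.
Proof. by move=> uT; rewrite -sumy// sumr_ge0// => i _; exact: y_ge0. Qed.

Let y_le i u : 0 <= u <= T -> y i u <= Y u.
Proof.
move=> uT; rewrite -sumy// (bigD1 i)//= lerDl sumr_ge0// => k _; exact: y_ge0.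
Qed.

Let YZ u : 0 <= u <= T -> (Y u = 0) \/ (Z u = 0).
Proof. by move=> /YZ0; case: leP => _ ->; [left|right]. Qed.

Let SE u : 0 <= u <= T -> S u = Y u - Z u - \sum_i w i u.
Proof.
move=> uT; rewrite -sumx// -sumrB; apply: eq_bigr => i _.
by rewrite xE// addrC addKr.
Qed.

Let sumw_bnd u : 0 <= u <= T -> - M <= \sum_i w i u <= M.
Proof. by move=> /sumw_le; rewrite ler_norml. Qed.

Let w_bnd i u : 0 <= u <= T -> - M <= w i u <= M.
Proof. by move=> /(w_le i); rewrite ler_norml. Qed.

Let mlb_sumh : mlb_on +oo%E (fun t => \sum_i h i t).
Proof. exact: mlb_sum. Qed.

Let S_Jint u : S u = Jint (fun t => \sum_i h i t) u.
Proof. by rewrite Jint_sum. Qed.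

(** Below level [- M] the value [x i] is negative, so [- lam i * x i] pushes upwards, and
    [theta i <= lam i] makes the contribution of [y i] nonnegative. *)
Let eta_ge i u : i != i0 -> lam i < Lam -> 0 <= u <= T -> - M <= eta i u.
Proof.
have M1 := M_ge1.
move=> ii0 li uT.
have := @Jint_barrier R (h i) 0 M T (mlb_h i) T_ge0.
have HM : - M <= 0 by lra.
move=> /(_ HM) H; have {}H := H _ u uT; rewrite add0r in H; apply: H => s sT.
rewrite add0r hE// (negbTE ii0) mul0r addr0 xE// => hs.
have h1 : 0 <= (lam i - theta i) * y i s.
  by rewrite mulr_ge0 ?y_ge0// subr_ge0 theta_le.
have h2 : 0 <= lam i * (- w i s - Jint (h i) s).
  by rewrite mulr_ge0 ?ltW//; have := w_bnd i sT; lra.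
lra.
Qed.

(** The depth common to both barriers. The one for [eta i0] is conditional because
    [theta i0 <= lam i0] is available only when [lam i0 < Lam]; otherwise the weight [Lam - lam i0]
    in the drift of the total is zero. *)
Let lower m := 0 <= m /\ forall u, 0 <= u <= T ->
  - m <= S u /\ (lam i0 < Lam -> - m <= eta i0 u).

Let Z_le m u : lower m -> 0 <= u <= T -> Z u <= m + M.
Proof.
have M1 := M_ge1.
move=> [m0 lm] uT; have [lS _] := lm _ uT; rewrite SE// in lS.
have := sumw_bnd uT; case: (YZ uT) => e0; rewrite e0 ?sub0r in lS *; lra.
Qed.

Let lower_ex : exists m, lower m.
Proof.
have Hb (f : R -> R) : mlb_on +oo%E f ->
    exists2 m, 0 <= m & forall u, 0 <= u <= T -> - m <= Jint f u.
  move=> mf; have mJ := mlb_continuous (continuous_Jint mf).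
  have [m m0 Hm] := mlb_bounded T mJ; exists m => // u /Hm.
  by rewrite ler_norml => /andP[].
have [m1 m10 H1] := Hb _ mlb_sumh; have [m2 m20 H2] := Hb _ (mlb_h i0).
exists (m1 + m2); split; first exact: addr_ge0.
move=> u uT; rewrite S_Jint /eta; have := H1 _ uT; have := H2 _ uT.
by split; lra.
Qed.

(** Each barrier is improved through the other: a bound on the total bounds [Z], hence the downward
    push on class [i0], while a bound on [eta i0] limits the downward drift of the total. *)
Let lower_step m : lower m -> lower (q * m + (2 + 2 * K1 / (Lam - rho)) * M).
Proof.
have M1 := M_ge1.
move=> lm; have [m0 lmu] := lm.
have M0 : 0 <= M by lra.
have k0 : 0 <= 2 * K1 / (Lam - rho) by rewrite divr_ge0 ?mulr_ge0// ltW.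
have q1 : rho / lam i0 <= q by rewrite /q le_max lexx.
have q2 : (Lam - lam i0) / (Lam - rho) <= q by rewrite /q le_max lexx orbT.
have [rho0 rholt] := andP rho_lt.
set B := _ + _ * M.
have qm0 : 0 <= q * m by rewrite mulr_ge0.
have kM0 : 0 <= 2 * K1 / (Lam - rho) * M by rewrite mulr_ge0.
have BM : M <= B by rewrite /B; lra.
have B0 : 0 <= B by lra.
have NB0 : - B <= 0 by lra.
split=> // u uT; split; last first.
  move=> nuLam.
  have H := @Jint_barrier R (h i0) 0 B T (mlb_h i0) T_ge0 NB0.
  rewrite -[X in _ <= X]add0r; apply: H => // s sT; rewrite add0r => hs.
  rewrite hE// eqxx mul1r xE//.
  have h1 : 0 <= (lam i0 - theta i0) * y i0 s.
    by rewrite mulr_ge0 ?y_ge0// subr_ge0 theta_le.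
  have h2 : rho * Z s <= rho * (m + M) by rewrite ler_wpM2l// Z_le.
  have h3 : rho * (m + M) <= lam i0 * (q * (m + M)).
    have -> : rho = lam i0 * (rho / lam i0) by field; exact: lt0r_neq0.
    rewrite -mulrA (ler_wpM2l (ltW (lam_gt0 i0)))// ler_wpM2r//; lra.
  have h4 : q * M <= 1 * M by rewrite ler_wpM2r// ltW.
  have h5 : 0 <= lam i0 * (- w i0 s - Jint (h i0) s - q * (m + M)).
    rewrite mulr_ge0 ?ltW//.
    have := w_bnd i0 sT; move: hs; rewrite /B; lra.
  have := d_ge sT; lra.
have H := @Jint_barrier R _ 0 B T mlb_sumh T_ge0 NB0.
rewrite -[X in _ <= X]add0r S_Jint; apply: H => // s sT; rewrite add0r -S_Jint => hs.
have hw := sumw_bnd sT.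
(* So low a total forces idleness, hence an empty queue, and all the [y i] disappear from the
   drift. *)
have Zpos : 0 < Z s.
  move: hs; rewrite SE//; have := Y_ge0 sT; lra.
have Y0 : Y s = 0 by case: (YZ sT) => // Z0; rewrite Z0 ltxx in Zpos.
have ys i : y i s = 0.
  by apply/le_anti; rewrite y_ge0// andbT -Y0 y_le.
have ZS : - S s - M <= Z s.
  by rewrite SE// Y0; lra.
(* Comparing every rate with [Lam] leaves nonnegative weights that vanish for the classes of maximal
   rate, so only the classes with a known lower bound matter. *)
have -> : \sum_i h i s = (Lam * Z s + d s) + \sum_i (Lam - lam i) * x i s.
  under eq_bigr => i _ do rewrite hE// ys mulr0 addr0.
  rewrite big_split/= (bigD1 i0)//= [X in _ + X](bigD1 i0)//= eqxx mul1r.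
  rewrite [X in _ + (_ + X)]big1 => [|i /negbTE ->]; last by rewrite mul0r.
  rewrite -(bigD1 (P := xpredT) i0)//=.
  under [X in _ = _ + X]eq_bigr => i _ do rewrite mulrBl -mulNr.
  by rewrite big_split/= -mulr_sumr sumx// Y0; ring.
have h1 : - (K1 * (2 * M)) - (Lam - lam i0) * m <= \sum_i (Lam - lam i) * x i s.
  rewrite /K1 mulr_suml (bigD1 i0)//= [X in _ <= X](bigD1 i0)//=.
  have a1 : - \sum_(i < n | i != i0) (Lam - lam i) * (2 * M) <=
      \sum_(i < n | i != i0) (Lam - lam i) * x i s.
    rewrite -sumrN ler_sum// => i ii0; rewrite -mulrN.
    have := lam_max i; rewrite le_eqVlt => /predU1P[->|li].
      by rewrite subrr !mul0r.
    rewrite ler_wpM2l//; first by rewrite subr_ge0 ltW.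
    by have := w_bnd i sT; have := eta_ge ii0 li sT; rewrite xE// /eta; lra.
  have a2 : - ((Lam - lam i0) * (2 * M)) - (Lam - lam i0) * m <=
      (Lam - lam i0) * x i0 s.
    have := lam_max i0; rewrite le_eqVlt => /predU1P[->|li].
      by rewrite subrr !mul0r; lra.
    rewrite -mulrN -mulrBr ler_wpM2l//; first by rewrite subr_ge0 ltW.
    have [_ /(_ li)] := lmu _ sT; have := w_bnd i0 sT; rewrite xE// /eta; lra.
  lra.
have h2 : (Lam - rho) * (q * m + 2 * K1 / (Lam - rho) * M) <= (Lam - rho) * Z s.
  rewrite (ler_wpM2l (ltW Lam_rho))//; move: hs ZS; rewrite /B; lra.
have h3 : (Lam - rho) * (2 * K1 / (Lam - rho) * M) = 2 * K1 * M.
  by field; exact: lt0r_neq0.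
have h4 : (Lam - lam i0) * m <= (Lam - rho) * (q * m).
  rewrite mulrA ler_wpM2r// -ler_pdivrMl//; rewrite mulrC; exact: q2.
have := d_ge sT; lra.
Qed.

Let lower_Cm : lower (Cm * M).
Proof.
have M1 := M_ge1.
have M0 : 0 < M by lra.
(* The slack [M] accounts for the final [+ 1] in [Cm]. *)
have := @contraction_invariant_small R lower q ((2 + 2 * K1 / (Lam - rho)) * M) M.
case; [exact: lower_ex | by move=> m [] | exact: lower_step | by rewrite q_ge0 q_lt1
      | exact: M0 |].
move=> m lm mC; have [m0 lmu] := lm.
have mC' : m <= Cm * M.
  apply: le_trans mC _.
  by rewrite le_eqVlt; apply/orP; left; apply/eqP; rewrite /Cm; ring.
split; first by lra.
by move=> u uT; have [h1 h2] := lmu _ uT; split=> [|/h2]; lra.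
Qed.

Let Z_bnd u : 0 <= u <= T -> Z u <= (Cm + 1) * M.
Proof. by move=> uT; rewrite mulrDl mul1r; exact: Z_le lower_Cm uT. Qed.

Let eta_ge_Cm i u : lam i < Lam -> 0 <= u <= T -> - ((Cm + 1) * M) <= eta i u.
Proof.
have M1 := M_ge1; have Cm1 := Cm_ge1.
move=> li uT; have M0 : 0 <= M by lra.
have h1 : M <= Cm * M by rewrite ler_peMl.
have [ii0|ni0] := eqVneq i i0.
  have [_ H] := lower_Cm; have [_] := H _ uT; rewrite -ii0 => /(_ li); lra.
have := eta_ge ni0 li uT; lra.
Qed.

Let D_ge0 : 0 <= D.
Proof.
have Cm1 := Cm_ge1. by rewrite /D mulr_ge0// addr_ge0// ?divr_ge0// ?ltW//; lra. Qed.

Let Y_bnd u : 0 <= u <= T -> Y u <= D2 * (1 + T) * M.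
Proof.
have M1 := M_ge1; have Cm1 := Cm_ge1.
move=> uT.
(* The weights [1 / lam i] turn the drift [- lam i * x i] into [- \sum_i x i = Z - Y]. *)
pose hV t := \sum_i (lam i)^-1 * h i t.
have mhV : mlb_on +oo%E hV by apply: mlb_sum => i; exact: mlbZ.
have VE t : Jint hV t = \sum_i (lam i)^-1 * eta i t.
  rewrite Jint_sum; last by move=> i; exact: mlbZ.
  by apply: eq_bigr => i _; rewrite JintZ.
have hVle s : 0 <= s <= T -> hV s <= D * M.
  move=> sT.
  (* As [theta i >= 0], the sum over [y] is at most [Y], which cancels [- Y]; only multiples of [Z]
     remain. *)
  have -> : hV s = - (Y s - Z s) + \sum_i (1 - theta i / lam i) * y i s + d s / lam i0.
    rewrite -sumx// -sumrN /hV.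
    rewrite [X in _ = _ + X](_ : _ = \sum_i (i == i0)%:R * (d s / lam i)).
      rewrite -!big_split/=; apply: eq_bigr => i _; rewrite hE//.
      by field; exact: lt0r_neq0.
    rewrite (bigD1 i0)//= eqxx mul1r big1 ?addr0// => i /negbTE ->.
    by rewrite mul0r.
  have h1 : \sum_i (1 - theta i / lam i) * y i s <= Y s.
    rewrite -sumy// ler_sum// => i _; rewrite ler_piMl ?y_ge0//.
    by rewrite gerBl divr_ge0// ltW.
  have h2 : d s / lam i0 <= c / lam i0 * Z s.
    by rewrite mulrAC ler_wpM2r ?d_le// invr_ge0 ltW.
  have h3 : (1 + c / lam i0) * Z s <= (1 + c / lam i0) * ((Cm + 1) * M).
    rewrite ler_wpM2l ?Z_bnd// addr_ge0// divr_ge0// ltW//.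
  rewrite /D; lra.
have u0 : 0 <= u by case/andP: uT.
have V_le : Jint hV u <= D * M * u.
  have := @Jint_incr_le R (D * M) hV 0 u mhV.
  rewrite (@Jint_le0 _ _ 0)// !subr0 lexx u0; apply => // v vu.
  by apply: hVle; lra.
have S_le : S u <= Lam * (D * M * u) + K2 * ((Cm + 1) * M).
  (* The subtracted coefficients are nonnegative and vanish when [lam i = Lam], so the lower bounds
     on the other [eta i] suffice to bound [S] above. *)
  have -> : S u = Lam * Jint hV u - \sum_i (Lam / lam i - 1) * eta i u.
    by rewrite VE mulr_sumr -sumrB; apply: eq_bigr => i _; ring.
  have h1 : Lam * Jint hV u <= Lam * (D * M * u) by rewrite ler_wpM2l// ltW.
  have h2 : - (K2 * ((Cm + 1) * M)) <= \sum_i (Lam / lam i - 1) * eta i u.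
    rewrite /K2 mulr_suml -sumrN ler_sum// => i _; rewrite -mulrN.
    have := lam_max i; rewrite le_eqVlt => /predU1P[li|li].
      by rewrite -li divff ?subrr ?mul0r// lt0r_neq0.
    by rewrite ler_wpM2l ?eta_ge_Cm// subr_ge0 ler_pdivlMr// mul1r ltW.
  lra.
have e0 : 0 <= K2 * (Cm + 1) by rewrite mulr_ge0//; lra.
have e1 : 0 <= Lam * D by rewrite mulr_ge0// ltW.
have rhs0 : Lam * (D * M * u) + K2 * ((Cm + 1) * M) + M <= D2 * (1 + T) * M.
  have -> : Lam * (D * M * u) + K2 * ((Cm + 1) * M) + M =
    (Lam * D * u + K2 * (Cm + 1) + 1) * M by ring.
  rewrite ler_wpM2r//; first lra.
  have f1 : Lam * D * u <= Lam * D * T by rewrite ler_wpM2l//; lra.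
  have f2 : 0 <= (K2 * (Cm + 1) + 1) * T by rewrite mulr_ge0//; lra.
  rewrite /D2; lra.
have S_ge : 0 <= Lam * (D * M * u) + K2 * ((Cm + 1) * M) + M.
  have M0 : 0 <= M by lra.
  have g1 : 0 <= Lam * D * (M * u) by exact: mulr_ge0 e1 (mulr_ge0 M0 u0).
  have g2 : 0 <= K2 * (Cm + 1) * M by exact: mulr_ge0.
  lra.
have := sumw_bnd uT; have := SE uT; case: (YZ uT) => e; rewrite e; lra.
Qed.

(** Once [Y] and [Z] are bounded, [eta i] solves a linear equation with decay rate [lam i] and a
    source of size at most [lam i * G]. Barriers at [- G] and [G] confine it. *)
Lemma reduced_system_bound i u : 0 <= u <= T ->
  `|x i u| <= reduced_system_cst i * (1 + T) * M.
Proof.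
have M1 := M_ge1; have T0 := T_ge0; have Cm1 := Cm_ge1; have c0 := c_ge0.
move=> uT.
have [rho0 rholt] := andP rho_lt.
have D20 : 0 <= D2.
  have g1 : 0 <= Lam * D by exact: mulr_ge0 (ltW Lam_gt0) D_ge0.
  have g2 : 0 <= K2 * (Cm + 1) by apply: mulr_ge0; [exact: K2_ge0|lra].
  rewrite /D2; lra.
pose G := ((lam i + theta i) * D2 + (rho + c) * (Cm + 1) + lam i) / lam i * (1 + T) * M.
have lG : lam i * G =
    ((lam i + theta i) * D2 + (rho + c) * (Cm + 1) + lam i) * (1 + T) * M.
  by rewrite /G; field; exact: lt0r_neq0.
have T1 : 0 <= T * M by rewrite mulr_ge0//; lra.
have src s : 0 <= s <= T ->
    `|(lam i - theta i) * y i s + (i == i0)%:R * d s - lam i * w i s| <= lam i * G.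
  move=> sT; rewrite lG.
  have a1 : `|(lam i - theta i) * y i s| <= (lam i + theta i) * (D2 * (1 + T) * M).
    rewrite normrM; apply: ler_pM => //.
      by apply: le_trans (ler_normB _ _) _; rewrite !ger0_norm// ltW.
    by rewrite ger0_norm ?y_ge0//; exact: le_trans (y_le i sT) (Y_bnd sT).
  have a2 : `|(i == i0)%:R * d s| <= (rho + c) * ((Cm + 1) * M).
    rewrite normrM; apply: (@le_trans _ _ `|d s|).
      by rewrite ler_piMl//; case: (i == i0); rewrite ?normr1 ?normr0.
    have b1 : rho * Z s <= rho * ((Cm + 1) * M) by rewrite ler_wpM2l ?Z_bnd.
    have b2 : c * Z s <= c * ((Cm + 1) * M) by rewrite ler_wpM2l ?Z_bnd.
    have b3 : 0 <= (Cm + 1) * M by rewrite mulr_ge0//; lra.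
    have b4 : 0 <= c * ((Cm + 1) * M) by rewrite mulr_ge0.
    have b5 : 0 <= rho * ((Cm + 1) * M) by rewrite mulr_ge0.
    rewrite ler_norml; have := d_ge sT; have := d_le sT.
    by move=> *; apply/andP; split; lra.
  have a3 : `|lam i * w i s| <= lam i * M.
    by rewrite normrM (gtr0_norm (lam_gt0 i)) ler_wpM2l ?w_le// ltW.
  have a4 : 0 <= ((rho + c) * (Cm + 1) + lam i) * (T * M).
    have g1 : 0 <= (rho + c) * (Cm + 1) by apply: mulr_ge0; lra.
    by apply: mulr_ge0 => //; have := lam_gt0 i; lra.
  apply: le_trans (ler_normB _ _) _.
  have := ler_normD ((lam i - theta i) * y i s) ((i == i0)%:R * d s).
  lra.
have hi s : 0 <= s <= T -> h i s = - lam i * eta i s +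
    ((lam i - theta i) * y i s + (i == i0)%:R * d s - lam i * w i s).
  by move=> sT; rewrite hE// xE// /eta; ring.
have G0 : - G <= 0.
  have := src _ uT; move/(le_trans (normr_ge0 _)); rewrite pmulr_rge0//; lra.
have low : - G <= eta i u.
  rewrite -[X in _ <= X]add0r; apply: (Jint_barrier (mlb_h i) T_ge0 G0) => // s sT.
  rewrite add0r hi// => hs.
  have b1 : 0 <= lam i * (- eta i s - G).
    by rewrite mulr_ge0 ?ltW//; rewrite /eta; lra.
  by have := src _ sT; rewrite ler_norml; lra.
have up : eta i u <= G.
  suff : - G <= 0 + Jint (fun t => -1 * h i t) u by rewrite JintZ// /eta; lra.
  apply: (Jint_barrier (mlbZ (-1) (mlb_h i)) T_ge0 G0) => // s sT.
  rewrite add0r JintZ// hi// => hs.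
  have b1 : 0 <= lam i * (eta i s - G).
    by rewrite mulr_ge0 ?ltW//; rewrite /eta; lra.
  by have := src _ sT; rewrite ler_norml; lra.
rewrite xE//; have := w_bnd i uT => wb.
have -> : reduced_system_cst i * (1 + T) * M = G + (1 + T) * M.
  by rewrite /reduced_system_cst /G; ring.
rewrite ler_norml; move: low up; rewrite /eta => low up.
by apply/andP; split; lra.
Qed.

End reduced_system.

(** * Growth bound *)

(** Local boundedness of [w] makes the set of norms bounded, so that [sup] is a genuine supremum. *)
Lemma norm1_le_supnorm (R : realType) (n : nat) (w : 'I_n -> R -> R) (s t : R) :
  (forall i, mlb_on +oo%E (w i)) -> 0 <= s <= t ->
  norm1 (fun i => w i s) <= supnorm w t.
Proof.
move=> mw st; rewrite /supnorm; apply: ub_le_sup; last first.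
  by exists s => //=; rewrite in_itv.
have /fin_all_exists[F HF] i : exists F : R, forall u, 0 <= u <= t -> `|w i u| <= F.
  by have [F _ HF] := mlb_bounded t (mw i); exists F.
exists (\sum_i F i) => _ [u ut <-]; apply: ler_sum => i _.
by apply: HF; move: ut; rewrite /= in_itv.
Qed.

Lemma double_star_bound (R : realType) (nI nJ : nat)
    (E : 'I_nI -> 'I_nJ -> bool) (mu : 'I_nI -> 'I_nJ -> R) (theta : 'I_nI -> R)
    (i0 : 'I_nI) (j0 : 'I_nJ) :
  (forall i j, E i j = (i == i0) || (j == j0)) ->
  (forall i j, E i j -> 0 < mu i j) ->
  (forall i j, ~~ E i j -> mu i j = 0) ->
  (forall i, 0 <= theta i) ->
  (forall a b, mu b j0 < mu a j0 -> theta b <= mu b j0) ->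
  exists C : R, forall psi y z w, sol_on E mu theta +oo%E psi y z w ->
    forall t : R, 0 <= t ->
    norm1 (fun i => xproc mu theta psi y w i t) <= C * (1 + t) * (1 + supnorm w t).
Proof.
move=> EE mu_gt0 mu0 theta0 rates.
pose lam i := mu i j0; pose nu j := mu i0 j.
have lam_gt0 i : 0 < lam i by apply: mu_gt0; rewrite EE eqxx orbT.
have nu_gt0 j : 0 < nu j by apply: mu_gt0; rewrite EE eqxx.
have [im _ lam_max] := arg_maxP lam (erefl : xpredT i0).
have [jm _ nu_min] := arg_minP nu (erefl : xpredT j0).
(* [rho] is the largest value of [lam i0 - nu j]. It is nonnegative because [nu j0 = lam i0], and
   below [lam i0] because the rates [nu j] are positive. *)
pose rho := lam i0 - nu jm; pose c := \sum_j nu j.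
have rho_lt : 0 <= rho < lam i0.
  by rewrite /rho; have := nu_gt0 jm; have := nu_min j0 isT; rewrite /nu /lam; lra.
have c0 : 0 <= c by apply: sumr_ge0 => j _; exact: ltW.
have nu_le_c j : nu j <= c.
  by rewrite /c (bigD1 j)//= lerDl sumr_ge0// => k _; exact: ltW.
pose C i := reduced_system_cst i0 lam theta (lam im) rho c i.
exists (\sum_i C i) => psi y z w [mpsi [my [mz [mw [psi0 [S1 [S2 [S3 S4]]]]]]]] t t0.
have Ivt u : 0 <= u <= t -> Iv +oo%E u by move=> /andP[u0 _]; split => //; exact: ltry.
pose M := 1 + supnorm w t.
pose x i u := xproc mu theta psi y w i u.
pose h i := (fun u => \sum_j - mu i j * psi i j u) \+ (fun u => - theta i * y i u).
pose Y u := \sum_i y i u; pose Z u := \sum_j z j u.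
pose d u := \sum_j (nu j - lam i0) * z j u.
have mh i : mlb_on +oo%E (h i).
  by apply: mlbD; [apply: mlb_sum => j|]; exact: mlbZ.
have xE i u : x i u = w i u + Jint (h i) u.
  rewrite /h JintD; [|by apply: mlb_sum => j; exact: mlbZ|exact: mlbZ].
  rewrite Jint_sum; last by move=> j; exact: mlbZ.
  rewrite JintZ// /x /xproc mulNr addrA -sumrN; congr (_ + _ - _).
  by apply: eq_bigr => j _; rewrite JintZ// mulNr.
have xS i u : 0 <= u <= t -> x i u = \sum_j psi i j u + y i u.
  move=> ut; have := S1 i u (Ivt _ ut); rewrite big_split/= /x /xproc; lra.
have hE i u : 0 <= u <= t -> h i u =
    - lam i * x i u + (lam i - theta i) * y i u + (i == i0)%:R * d u.
  move=> ut; rewrite xS// /h /=.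
  (* The term [j = j0] vanishes. For [j != j0] the only neighbour is [i0], so (S2) gives
     [psi i0 j = - z j]. *)
  suff -> : (i == i0)%:R * d u = \sum_j (lam i - mu i j) * psi i j u.
    under [X in _ = _ + X]eq_bigr => j _ do rewrite mulrBl -mulNr.
    by rewrite big_split/= -mulr_sumr; ring.
  have [->|ii0] := eqVneq i i0; last first.
    rewrite mul0r big1// => j _; have [->|jj0] := eqVneq j j0.
      by rewrite subrr mul0r.
    by rewrite psi0 ?mulr0//; [rewrite EE negb_or ii0 jj0|exact: Ivt ut].
  rewrite mul1r; apply: eq_bigr => j _; have [->|jj0] := eqVneq j j0.
    by rewrite subrr !mul0r.
  have := S2 j u (Ivt _ ut); rewrite (bigD1 i0)//= big1 => [|i' ii'].
    by rewrite addr0 => ->; rewrite /nu /lam; ring.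
  by rewrite psi0//; [rewrite EE negb_or ii' jj0|exact: Ivt ut].
have y0 i u : 0 <= u <= t -> 0 <= y i u by move=> ut; exact: (S3 u (Ivt _ ut)).1.
have z0 j u : 0 <= u <= t -> 0 <= z j u by move=> ut; exact: (S3 u (Ivt _ ut)).2.
have Z0 u : 0 <= u <= t -> 0 <= Z u by move=> ut; apply: sumr_ge0 => j _; exact: z0.
have sumx u : 0 <= u <= t -> \sum_i x i u = Y u - Z u.
  move=> ut; under eq_bigr => i _ do rewrite xS//.
  rewrite big_split/= exchange_big/= addrC; congr (_ + _).
  by rewrite /Z -sumrN; apply: eq_bigr => j _; exact: S2 (Ivt _ ut).
have d_ge u : 0 <= u <= t -> - rho * Z u <= d u.
  move=> ut; rewrite /Z mulr_sumr ler_sum// => j _; rewrite ler_wpM2r ?z0//.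
  by have := nu_min j isT; rewrite /rho; lra.
have d_le u : 0 <= u <= t -> d u <= c * Z u.
  move=> ut; rewrite /Z mulr_sumr ler_sum// => j _; rewrite ler_wpM2r ?z0//.
  by have := nu_le_c j; have := lam_gt0 i0; lra.
have wM s : 0 <= s <= t -> norm1 (fun i => w i s) <= M.
  by move=> st; apply: le_trans (norm1_le_supnorm mw st) _; rewrite lerDr.
have M1 : 1 <= M.
  rewrite lerDl; have t00 : 0 <= (0 : R) <= t by rewrite lexx.
  apply: le_trans (norm1_le_supnorm mw t00); exact: sumr_ge0.
rewrite mulr_suml mulr_suml; apply: ler_sum => i _.
apply: (@reduced_system_bound _ _ i0 lam theta (lam im) rho c _ _ _ _ _ _
  x y w h Y Z d M t) => //.
- by move=> k; exact: lam_max.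
- by move=> k; exact: rates.
- move=> k u ut; apply: le_trans (wM _ ut).
  by rewrite /norm1 (bigD1 k)//= lerDl sumr_ge0.
- by move=> u ut; apply: le_trans (wM _ ut); exact: ler_norm_sum.
- by move=> u ut; exact: S4 (Ivt _ ut).
- by rewrite t0 lexx.
Qed.

Theorem theorem3 (R : realType) (nI nJ : nat) (E : 'I_nI -> 'I_nJ -> bool)
    (mu : 'I_nI -> 'I_nJ -> R) (theta : 'I_nI -> R) :
  (forall i j, E i j -> 0 < mu i j) ->
  (forall i j, ~~ E i j -> mu i j = 0) ->
  (forall i, 0 <= theta i) ->
  is_tree (bip_adj E) ->
  diameter_eq (bip_adj E) 3 ->
  nonidling E mu theta ->
  exists m4 : R, forall psi y z w,
    sol_on E mu theta +oo%E psi y z w ->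
    forall t : R, 0 <= t ->
      norm1 (fun i => xproc mu theta psi y w i t)
        <= m4 * (1 + t) `^ m4 * (1 + supnorm w t).
Proof.
move=> mu_gt0 mu0 theta0 [_ acyc] diam nidl.
have [i0 [j0 EE]] := diameter3_tree_double_star acyc diam.
have Ej0 i : E i j0 by rewrite EE eqxx orbT.
have rates a b : mu b j0 < mu a j0 -> theta b <= mu b j0.
  by apply: (nonidling_abandonment_le Ej0 nidl) => i; exact: mu_gt0.
have [C HC] := double_star_bound EE mu_gt0 mu0 theta0 rates.
(* The same constant serves as factor and exponent: being at least 1, it makes the power of [1 + t]
   dominate [1 + t] itself. *)
exists (Num.max 1 C) => psi y z w sol t t0.
apply: le_trans (HC _ _ _ _ sol _ t0) _.
have sw0 : 0 <= supnorm w t.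
  have [_ [_ [_ [mw _]]]] := sol; have t00 : 0 <= (0 : R) <= t by rewrite lexx.
  apply: le_trans (norm1_le_supnorm mw t00); exact: sumr_ge0.
rewrite ler_wpM2r ?addr_ge0//.
apply: (@le_trans _ _ (Num.max 1 C * (1 + t))).
  by rewrite ler_wpM2r ?addr_ge0// le_max lexx orbT.
rewrite ler_wpM2l//; first by rewrite le_max ler01.
rewrite -[X in X <= _]powRr1 ?addr_ge0//.
by apply: ler_powR; rewrite ?lerDl// le_max lexx.
Qed.
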